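(* Let $T$ be a tree of maximum degree $\Delta \geq 3$. Then Schäffer's algorithm finds a centered coloring (vertex ranking) of $T$ of size at most $(\log_2 \Delta)\cdot \chi_{\text{lin}}(T)$. In particular, for trees of maximum degree $3$ the size is at most $(\log_2 3)\chi_{\text{lin}}(T)$.
   Context: A coloring of a graph $G$ is a map $\psi: V(G)\to\{1,\dots,k\}$; its size is $k$. For a subgraph $H$, a vertex $v\in V(H)$ is a center of $H$ if $\psi(v)$ is the color of no other vertex of $H$. A centered coloring is a coloring in which every connected subgraph has a center. A linear coloring is a coloring in which every path (as a subgraph, not necessarily induced) has a center; $\chi_{\text{lin}}(G)$ is the minimum size of a linear coloring of $G$. A vertex ranking is a coloring $r$ by positive integers (ranks) such that in every connected subgraph the vertex of maximum rank is unique; it is a centered coloring. Schäffer's algorithm (Schäffer 1989) computes a vertex ranking of a tree $T$ as follows: root $T$ at an arbitrary vertex (in the paper, an arbitrary leaf) and process vertices from the leaves upward. For a vertex $u$ with subtree $T_u$, the rank list $L(u)$ is the set of ranks $r(w)$ of vertices $w\in T_u$ such that $r(w)$ exceeds the rank of every other vertex on the $w$–$u$ path in $T$. For a vertex $v$ with children $u_1,\dots,u_\ell$, let $x$ be the largest integer appearing in the rank lists of at least two children (or $0$ if the rank lists $L(u_i)$ are pairwise disjoint); then $r(v)$ is the smallest integer with $r(v) > x$ and $r(v)\notin \bigcup_{i=1}^\ell L(u_i)$. The size of the resulting centered coloring is the number of distinct ranks (the maximum rank) used. *)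

(* Defs.v *)
From HB Require Import structures.
From mathcomp Require Import all_boot all_order all_algebra.
From mathcomp Require Import boolp reals exp.

Set Implicit Arguments.
Unset Strict Implicit.
Unset Printing Implicit Defensive.

Definition log2 (R : realType) (x : R) : R := (ln x / ln 2)%R.

Section Graphs.

Variables (V : finType) (e : rel V).

(* A walk is a start vertex x together with the sequence p of the vertices
   that follow it, so its length is size p. *)
Definition simple_path (x : V) (p : seq V) : bool :=
  path e x p && uniq (x :: p).

(* In a simple graph a cycle has at least three vertices; the bound excludes
   the degenerate ucycle [:: x; y] running back and forth along an edge. *)
Definition is_tree : Prop :=
  [/\ symmetric e,
      irreflexive e,
      0 < #|V|,
      forall x y : V, connect e x y
    & forall s : seq V, 2 < size s -> ~ ucycle e s].

Definition degree (v : V) : nat := #|[set w | e v w]|.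

Definition max_degree : nat := \max_(v : V) degree v.

(* (S, f) is the subgraph with vertex set S and edge relation f. *)
Definition is_subgraph (S : {set V}) (f : rel V) : Prop :=
  symmetric f /\ forall x y, f x y -> [/\ e x y, x \in S & y \in S].

Definition connected_subgraph (S : {set V}) (f : rel V) : Prop :=
  [/\ is_subgraph S f, S != set0 & {in S &, forall x y, connect f x y}].

Definition is_coloring (k : nat) (c : V -> nat) : Prop :=
  forall v, 1 <= c v <= k.

(* Being a center of a subgraph depends only on its vertex set S. *)
Definition is_center (c : V -> nat) (S : {set V}) (v : V) : Prop :=
  v \in S /\ forall w, w \in S -> w != v -> c w != c v.

Definition centered_coloring (k : nat) (c : V -> nat) : Prop :=
  is_coloring k c /\
  forall S f, connected_subgraph S f -> exists v, is_center c S v.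

Definition linear_coloring (k : nat) (c : V -> nat) : Prop :=
  is_coloring k c /\
  forall x p, simple_path x p -> exists v, is_center c [set y in x :: p] v.

Definition vertex_ranking (k : nat) (r : V -> nat) : Prop :=
  is_coloring k r /\
  forall S f, connected_subgraph S f ->
    exists v, v \in S /\ forall w, w \in S -> w != v -> r w < r v.

Lemma linear_coloring_exists : exists k, `[< exists c, linear_coloring k c >].
Proof.
exists #|V|; apply/asboolP; exists (fun v => (enum_rank v).+1); split.
  by move=> v; rewrite /= ltn_ord.
move=> x p _; exists x; split; first by rewrite !inE eqxx.
move=> w _; apply: contraNneq => /succn_inj /val_inj /enum_rank_inj -> //.
Qed.

Definition chi_lin : nat := ex_minn linear_coloring_exists.

Section Schaffer.

Variable root : V.

(* Distance to the root; the value #|V| stands for unreachable vertices. *)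
Definition depth (v : V) : nat :=
  find (fun n => [exists p : n.-tuple V, path e root p && (last root p == v)])
       (iota 0 #|V|).

Definition child (v u : V) : bool := e v u && (depth u == (depth v).+1).

Definition children (v : V) : {set V} := [set u | child v u].

Definition subtree (u : V) : {set V} := [set w | connect child u w].

Definition dominates_path (r : V -> nat) (u w : V) : Prop :=
  exists p, [/\ simple_path u p, last u p = w
              & forall z, z \in u :: p -> z != w -> r z < r w].

Definition rank_list (r : V -> nat) (u : V) : seq nat :=
  [seq r w | w <- enum (subtree u) & `[< dominates_path r u w >]].

Definition child_ranks (r : V -> nat) (v : V) : seq nat :=
  flatten [seq rank_list r u | u <- enum (children v)].

(* The empty maximum is 0. *)
Definition max_repeated (r : V -> nat) (v : V) : nat :=
  \max_(k <- child_ranks r v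
        | 2 <= #|[set u in children v | k \in rank_list r u]|) k.

Lemma free_rank_exists (r : V -> nat) (v : V) :
  exists m, (max_repeated r v < m) && (m \notin child_ranks r v).
Proof.
set x := max_repeated r v; set s := child_ranks r v.
exists (maxn x (\max_(k <- s) k)).+1; rewrite ltnS leq_maxl /=.
apply/negP => /(@leq_bigmax_seq _ s xpredT (fun k => k)) /(_ isT).
by rewrite leqNgt ltnS leq_maxr.
Qed.

Definition next_rank (r : V -> nat) (v : V) : nat :=
  ex_minn (free_rank_exists r v).

(* Vertices not yet processed carry the dummy rank 0.  Deepest vertices come
   first, so next_rank r v only consults final ranks; the order of vertices of
   equal depth has no influence on the result. *)
Definition schaffer : V -> nat :=
  foldl (fun r v w => if w == v then next_rank r v else r w) (fun=> 0)
        (sort (fun u v => depth v <= depth u) (enum V)).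

End Schaffer.

(* The least k such that the positive ranks r form a coloring of size k. *)
Definition ranking_size (r : V -> nat) : nat := \max_(v : V) r v.

End Graphs.

(* Main.v *)
(** With [n] vertices, [p] colours in a linear colouring, and largest rank [k]
    given by Schäffer's algorithm, the bound follows from
    [2 ^ k <= 2 n <= (Delta - 1) n <= Delta ^ p].

    Left inequality: by induction on the tree, the sum of [2 ^ a] over the rank
    list of [v] is at most twice the size of the subtree of [v]. If [x] is the
    largest repeated rank at [v], the ranks strictly between [x] and [r v] all
    occur in the lists of the children and [x] occurs twice, so they pay for
    [2 ^ r v] as in a binary carry.

    Right inequality: label the [Delta] exits of each vertex by the elements of
    [Z / Delta]. Crossing a vertex [x] from exit [i] to exit [j <> i] adds [j - i]
    to the coordinate of the colour of [x], which gives every edge of the tree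
    (including [Delta - deg] dangling ones at each vertex) a potential in
    [(Z / Delta) ^ p]. The vertices between two distinct edges form a path; the
    colour of its centre is crossed exactly once, so the potentials differ. *)

Require Import Defs.
From HB Require Import structures.
From mathcomp Require Import all_boot all_order all_algebra.
From mathcomp Require Import boolp reals exp.

Set Implicit Arguments.
Unset Strict Implicit.
Unset Printing Implicit Defensive.

Import GRing.Theory Num.Theory.

(** * Depth, parents and descending paths in a rooted tree *)

Section RootedTree.

Variables (V : finType) (e : rel V) (root : V).
Hypothesis treeT : is_tree e.

Local Notation depth := (depth e root).
Local Notation child := (child e root).
Local Notation subtree := (subtree e root).

Lemma edge_sym : symmetric e.
Proof. by case: treeT. Qed.

Lemma edge_irr : irreflexive e.
Proof. by case: treeT. Qed.

(** The default value of [depth] never occurs: by connectedness some walk reaches [v], and once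
    shortened to a simple path it has fewer than [#|V|] edges. *)
Lemma depth_walk v :
  exists p : seq V, [/\ path e root p, last root p = v & size p = depth v].
Proof.
set a := fun n => [exists p : n.-tuple V, path e root p && (last root p == v)].
have has_a : has a (iota 0 #|V|).
  case: treeT => _ _ _ /(_ root v) /connectP[p0 e_p0 def_v] _.
  case/shortenP: e_p0 def_v => p e_p Up _ def_v.
  apply/hasP; exists (size p).
    by rewrite mem_iota add0n -[(size p).+1]/(size (root :: p)) -(card_uniqP Up) max_card.
  by apply/existsP; exists (in_tuple p); rewrite e_p def_v eqxx.
have lt_find : depth v < #|V| by rewrite -[X in _ < X](size_iota 0) -has_find.
have := nth_find 0 has_a; rewrite nth_iota // add0n => /existsP[p /andP[e_p /eqP last_p]].
by exists p; rewrite size_tuple.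
Qed.

Lemma depth_le_walk p : path e root p -> depth (last root p) <= size p.
Proof.
move=> e_p; set v := last root p.
have [lt_p|] := ltnP (size p) #|V|; last first.
  (* A walk this long meets the bound because [find] never exceeds the length [#|V|] of the searched
     list. *)
  move=> /(leq_trans _) -> //; rewrite -[X in _ <= X](size_iota 0).
  exact: find_size.
rewrite leqNgt; apply/negP => lt_d.
have := before_find 0 lt_d; rewrite nth_iota // add0n => /existsP[].
by exists (in_tuple p); rewrite e_p eqxx.
Qed.

Lemma depth_root : depth root = 0.
Proof. by apply/eqP; rewrite -leqn0 (@depth_le_walk [::]). Qed.

Lemma depth_eq0 v : (depth v == 0) = (v == root).
Proof.
apply/eqP/eqP => [|->]; last exact: depth_root.
by have [[|x p] [_ <- <-]] := depth_walk v.
Qed.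

Lemma depth_edge u v : e u v -> depth v <= (depth u).+1.
Proof.
move=> e_uv; have [p [e_p last_p <-]] := depth_walk u.
by have:= @depth_le_walk (rcons p v); rewrite rcons_path e_p last_p e_uv last_rcons size_rcons; apply.
Qed.

Lemma ex_parent v : v != root -> exists u, child u v.
Proof.
have [p [e_p last_p size_p]] := depth_walk v.
case/lastP: p => [|p w] in e_p last_p size_p; first by rewrite -last_p eqxx.
move: e_p last_p size_p; rewrite rcons_path last_rcons size_rcons => /andP[e_p e_w] eq_w size_p _.
exists (last root p); rewrite /Defs.child -eq_w e_w /= eq_w eqn_leq -{1}eq_w depth_edge //=.
by rewrite -size_p ltnS depth_le_walk.
Qed.

(** Climb from [x] through parents: every vertex after [x] is strictly less deep than [v], so [v] is
    never met. *)
Lemma connect_avoiding v x : x != v -> depth x <= depth v ->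
  connect [rel y z | [&& e y z, y != v & z != v]] root x.
Proof.
have [n] := ubnP (depth x); elim: n x => // n IHn x lt_n x_v le_xv.
have [->//|/ex_parent[y /andP[e_yx /eqP dx]]] := eqVneq x root.
have lt_yv : depth y < depth v by rewrite -dx.
have y_v : y != v by apply: contraTneq lt_yv => ->; rewrite ltnn.
apply: connect_trans (IHn y _ y_v (ltnW lt_yv)) _; first by rewrite -dx.
by apply: connect1; rewrite /= e_yx y_v.
Qed.

(* Two such neighbours are joined through the root by a path avoiding [v],
   which closes a cycle through [v]. *)
Lemma unique_upper_neighbour v a b :
  e v a -> e v b -> depth a <= depth v -> depth b <= depth v -> a = b.
Proof.
move=> e_va e_vb le_a le_b; apply/eqP/negPn/negP => a_b.
have neq_v x : e v x -> x != v by apply: contraTneq => ->; rewrite edge_irr.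
set e' := [rel y z | [&& e y z, y != v & z != v]].
have sym_e' : connect_sym e'.
  by apply: sym_connect_sym => y z; rewrite /= edge_sym andbCA andbC -andbA andbC -andbA andbCA.
have: connect e' a b.
  by apply: connect_trans (connect_avoiding _ le_b); rewrite ?neq_v // sym_e' connect_avoiding ?neq_v.
case/connectP => p0 e_p0 def_b; case/shortenP: e_p0 def_b => p e_p Up _ def_b.
case: treeT => _ _ _ _ /(_ (v :: a :: p)); apply.
  by case: p {e_p Up} def_b => //= def_b; rewrite def_b eqxx in a_b.
have v_p : v \notin a :: p.
  have avoid_v x q : path e' x q -> v \notin q.
    elim: q x => //= y q IHq x /andP[/and3P[_ _ y_v] /IHq].
    by rewrite inE eq_sym (negPf y_v).
  by rewrite inE eq_sym (negPf (neq_v a e_va)) (avoid_v a).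
apply/andP; split; last by rewrite /= in v_p Up *; rewrite v_p.
rewrite /= rcons_path e_va -def_b edge_sym e_vb andbT /=.
by apply: sub_path e_p => y z /andP[].
Qed.

(** The end [v] that is at least as deep has a parent; the other end is also an upper neighbour of
    [v], hence is that parent. No edge stays within a level. *)
Lemma edge_child u v : e u v -> child u v || child v u.
Proof.
move=> e_uv; wlog le_uv : u v e_uv / depth u <= depth v.
  by have [/[swap]|/ltnW/[swap]] := leqP (depth u) (depth v) => [|IH]; [exact|]; move/IH; rewrite orbC edge_sym; exact.
apply/orP; left; rewrite /Defs.child e_uv /= eqn_leq depth_edge //=.
have v_root : v != root.
  apply: contraTneq e_uv => def_v; move: le_uv.
  by rewrite def_v depth_root leqn0 depth_eq0 => /eqP ->; rewrite edge_irr.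
have [a /andP[e_av /eqP dv]] := ex_parent v_root.
rewrite (@unique_upper_neighbour v u a) ?dv // 1?edge_sym //; first by rewrite -dv.
Qed.

Lemma unique_parent a b v : child a v -> child b v -> a = b.
Proof.
move=> /andP[e_av /eqP da] /andP[e_bv /eqP db].
by apply: (@unique_upper_neighbour v); rewrite 1?edge_sym // ?da // -da db.
Qed.

Lemma child_edge u v : child u v -> e u v.
Proof. by case/andP. Qed.

Lemma depth_child u v : child u v -> depth v = (depth u).+1.
Proof. by case/andP => _ /eqP. Qed.

Lemma child_neq_root u v : child u v -> v != root.
Proof. by move/depth_child => dv; rewrite -depth_eq0 dv. Qed.

Lemma connect_child_depth u v : connect child u v -> depth u <= depth v.
Proof.
case/connectP => p; elim: p u => [|x p IHp] u /=; first by move=> _ ->.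
by move=> /andP[/depth_child d_x c_p] /(IHp _ c_p); rewrite d_x; apply: ltnW.
Qed.

Lemma connect_childP u v : connect child u v ->
  u = v \/ exists2 w, connect child u w & child w v.
Proof.
case/connectP => p; case/lastP: p => [_ ->|p w]; first by left.
rewrite rcons_path last_rcons => /andP[c_p c_w] ->; right.
by exists (last u p) => //; apply/connectP; exists p.
Qed.

(** Parents are unique, so the two chains climbing from [w] coincide until one of them stops. *)
Lemma ancestors_comparable u v w : connect child u w -> connect child v w ->
  depth u <= depth v -> connect child u v.
Proof.
have [n] := ubnP (depth w); elim: n w => // n IHn w lt_n uw vw le_uv.
case: (connect_childP vw) => [->//|[y vy yw]].
case: (connect_childP uw) => [uw'|[x ux xw]].
  by move: le_uv; rewrite uw' (depth_child yw) ltnNge (connect_child_depth vy).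
rewrite (unique_parent xw yw) in ux; apply: (IHn y) => //.
by rewrite -(depth_child yw).
Qed.

Lemma connect_child_eq u v w : connect child u w -> connect child v w ->
  depth u = depth v -> u = v.
Proof.
move=> uw vw duv; have := ancestors_comparable uw vw (eq_leq duv).
case/connect_childP => // -[x /connect_child_depth le_ux /depth_child dv].
by move: le_ux; rewrite duv dv ltnn.
Qed.

Lemma path_child_simple u p : path child u p -> simple_path e u p.
Proof.
move=> c_p; rewrite /simple_path (sub_path child_edge c_p) /=.
elim: p u c_p => //= x p IHp u /andP[c_x c_p].
rewrite (IHp x c_p) andbT; apply/negP => /(path_connect c_p) /connect_child_depth.
by rewrite (depth_child c_x) ltnn.
Qed.

(* A simple path never turns from a child edge back to a parent edge, and once
   it has left [u] upwards it can only come back below [u] through [u]. *)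
Lemma simple_path_child u p : simple_path e u p -> last u p \in subtree u ->
  path child u p.
Proof.
rewrite inE.
have down x y q : simple_path e x (y :: q) -> child x y -> path child x (y :: q).
  elim: q x y => [|z q IHq] x y; first by move=> _ /= ->.
  rewrite /simple_path => /= /andP[/and3P[e_xy e_yz e_q] /andP[x_q U]] c_xy.
  rewrite c_xy /=; apply: (IHq y z); first by rewrite /simple_path /= e_yz e_q.
  case/orP: (edge_child e_yz) => // c_zy.
  by move: x_q; rewrite (unique_parent c_xy c_zy) !inE eqxx orbT.
(* To reach its end, the path must enter through every ancestor of that end lying deeper than the
   start. *)
have up x q : simple_path e x q -> forall w, connect child w (last x q) ->
    depth x < depth w -> w \in q.
  elim: q x => [|y q IHq] x.
    by move=> _ w /connect_child_depth /= /leq_ltn_trans lt_w /lt_w; rewrite ltnn.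
  move=> sp w wz lt_xw; have := sp; rewrite /simple_path /= => /andP[/andP[e_xy e_q] /andP[x_q U]].
  case/orP: (edge_child e_xy) => c_xy.
    move: lt_xw; rewrite -(depth_child c_xy) leq_eqVlt => /orP[/eqP dw|lt_yw].
      have/andP[_ c_q] := down _ _ _ sp c_xy.
      have yz : connect child y (last y q) by apply/connectP; exists q.
      by rewrite -(connect_child_eq yz wz dw) inE eqxx.
    by rewrite inE (IHq y) ?orbT // /simple_path e_q.
  rewrite inE (IHq y) ?orbT //; first by rewrite /simple_path e_q.
  by rewrite -ltnS -(depth_child c_xy) ltnW.
case: p => //= y p sp uz; have := sp; rewrite /simple_path => /= /andP[/andP[e_uy e_p] /andP[u_p U]].
case/orP: (edge_child e_uy) => c_uy; first exact: (down _ _ _ sp).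
(* After a first step up to [y], the claim [up] forces the path back through [u], against
   simplicity. *)
move: u_p; rewrite inE (up y p) ?orbT // ?(depth_child c_uy) //.
by rewrite /simple_path e_p.
Qed.

End RootedTree.

(** * Lower bound on the size of a linear coloring *)

Section LinearColoring.

Variables (V : finType) (e : rel V) (root : V).
Hypothesis treeT : is_tree e.

Local Notation depth := (depth e root).
Local Notation child := (child e root).
Local Notation children := (children e root).

Variable d : nat.
Hypothesis degree_le : forall v, degree e v <= d.+1.

Lemma card_children_root : #|children root| <= d.+1.
Proof.
apply: leq_trans (degree_le root); apply: subset_leq_card.
by apply/subsetP => u; rewrite !inE => /child_edge.
Qed.

Lemma card_children v : v != root -> #|children v| <= d.
Proof.
move=> /(ex_parent treeT)[a c_av]; have := degree_le v; rewrite /degree.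
rewrite (cardD1 a) inE edge_sym // (child_edge c_av) add1n ltnS; apply: leq_trans.
apply: subset_leq_card; apply/subsetP => u; rewrite !inE => c_vu.
rewrite (child_edge c_vu) andbT; apply: contraTneq c_vu => ->.
by rewrite /Defs.child (depth_child c_av) ltn_eqF ?andbF // leqW.
Qed.

(* The exits of a vertex are labelled by [0, .., d]; at every vertex other than
   the root, label 0 is kept for the edge to the parent. *)
Definition port (v u : V) : 'I_d.+1 :=
  inord (index u (enum (children v)) + (v != root)).

(** The default of [inord] is never taken: the root has at most [d.+1] children, labelled from 0,
    any other vertex at most [d], labelled from 1. *)
Lemma port_val v u : child v u ->
  port v u = index u (enum (children v)) + (v != root) :> nat.
Proof.
move=> c_vu; rewrite inordK //.
have: index u (enum (children v)) < #|children v|.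
  by rewrite cardE index_mem mem_enum inE.
have [->|v_root] := eqVneq v root; rewrite ?addn0 ?addn1.
  by move/leq_trans; apply; exact: card_children_root.
by rewrite !ltnS => /leq_trans; apply; exact: card_children.
Qed.

Lemma port_inj v u w : child v u -> child v w -> port v u = port v w -> u = w.
Proof.
move=> c_vu c_vw /(congr1 val) /=; rewrite !port_val // => /addIn.
by apply: (index_inj v); rewrite mem_enum inE.
Qed.

Lemma port_neq0 v u : v != root -> child v u -> port v u != 0%R.
Proof.
by move=> v_root c_vu; rewrite -val_eqE /= port_val // v_root addn1.
Qed.

Variables (k : nat) (c : V -> nat).
Hypothesis linear_c : linear_coloring e k c.

(* The total label, in colour [b], of the downward path [x :: p] continued
   through the exit [j] of its last vertex. *)
Fixpoint potential (x : V) (p : seq V) (j : 'I_d.+1) (b : nat) : 'I_d.+1 :=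
  if p is y :: q then
    ((if c x == b then port x y else 0) + potential y q j b)%R
  else if c x == b then j else 0%R.

Lemma potential_absent x p j b :
  (forall z, z \in x :: p -> c z != b) -> potential x p j b = 0%R.
Proof.
elim: p x => [|y p IHp] x no_b /=; first by rewrite (negPf (no_b x _)) ?inE.
rewrite (negPf (no_b x _)) ?inE ?eqxx // IHp ?addr0 // => z z_p.
by rewrite no_b // inE z_p orbT.
Qed.

(** In the colour of the centre [z] only the term of [z] survives. It is the label of a child of a
    non-root vertex or the final exit [j], both nonzero. *)
Lemma potential_center x p j z : x != root -> path child x p -> uniq (x :: p) ->
    j != 0%R -> z \in x :: p ->
    (forall w, w \in x :: p -> w != z -> c w != c z) ->
  potential x p j (c z) != 0%R.
Proof.
move=> + + + j0; elim: p x => [|y p IHp] x x_root.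
  by move=> _ _; rewrite mem_seq1 => /eqP -> _ /=; rewrite eqxx.
move=> /= /andP[c_xy c_p] /andP[x_p U]; rewrite inE => /predU1P[-> cz|z_p cz].
  rewrite eqxx potential_absent ?addr0 ?port_neq0 // => w w_p.
  by apply: cz; [rewrite inE w_p orbT|apply: contraNneq x_p => <-].
have x_z : x != z by apply: contraNneq x_p => ->.
rewrite (negPf (cz x _ x_z)) ?inE ?eqxx // add0r IHp ?(child_neq_root treeT c_xy) //.
by move=> w w_p; apply: cz; rewrite inE w_p orbT.
Qed.

Lemma path_child_uniq x p : path child x p -> uniq (x :: p).
Proof. by move/path_child_simple/andP => []. Qed.

Lemma siblings_disjoint x a b p q : child x a -> child x b -> a != b ->
    path child a p -> path child b q ->
  forall z, z \in a :: p -> z \notin b :: q.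
Proof.
move=> c_a c_b a_b c_p c_q z /(path_connect c_p) az.
apply: contraNN a_b => /(path_connect c_q) bz; apply/eqP.
by apply: (connect_child_eq treeT az bz); rewrite (depth_child c_a) (depth_child c_b).
Qed.

(** Climbing one branch to [x] and descending the other gives a simple path, so a linear coloring
    has a centre on it. *)
Lemma simple_path_bend x a b p q : child x a -> child x b -> a != b ->
    path child a p -> path child b q ->
  simple_path e (last a p) (rev (x :: belast a p) ++ b :: q).
Proof.
move=> c_a c_b a_b c_p c_q.
have disj := siblings_disjoint c_a c_b a_b c_p c_q.
have c_ap : path child x (a :: p) by rewrite /= c_a.
have c_bq : path child x (b :: q) by rewrite /= c_b.
have U1 := path_child_uniq c_ap; have U2 := path_child_uniq c_bq.
rewrite /simple_path; apply/andP; split.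
  rewrite cat_path; apply/andP; split.
    rewrite -[last a p]/(last x (a :: p)) -[x :: belast a p]/(belast x (a :: p)).
    rewrite rev_path (eq_path (e' := e)) ?(sub_path (@child_edge _ _ _) c_ap) //.
    by move=> u v; rewrite edge_sym.
  by rewrite rev_cons last_rcons (sub_path (@child_edge _ _ _) c_bq).
rewrite -cat_cons cat_uniq -rev_rcons rcons_cons -lastI rev_uniq U1.
move: U2; rewrite cons_uniq => /andP[x_q ->]; rewrite andbT andTb.
apply/hasPn => z z_q; rewrite mem_rev inE negb_or; apply/andP; split.
  by apply: contraNneq x_q => <-.
by apply/negP => /disj; rewrite z_q.
Qed.

(* The two descriptions differ along a path of the tree, and the centre of that
   path contributes a nonzero term in its own colour. *)
Lemma potential_inj x p q i j : path child x p -> path child x q ->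
    i != 0%R -> j != 0%R ->
    (forall b, 1 <= b <= k -> potential x p i b = potential x q j b) ->
  p = q /\ i = j.
Proof.
have col v : 1 <= c v <= k by case: linear_c.
have center y s : simple_path e y s -> exists2 z, z \in y :: s &
    forall w, w \in y :: s -> w != z -> c w != c z.
  case: linear_c => _ /[apply] -[z [z_s cz]]; exists z; first by rewrite inE in z_s.
  by move=> w w_s; apply: cz; rewrite inE.
(* One description stops at [x'], the other goes on to [y]. If the exit [i'] leads to [y], the
   labels at [x'] cancel and the separating path starts at [y]; otherwise it starts at [x']. *)
have nil_cons x' y s i' j' : path child x' (y :: s) -> j' != 0%R ->
    (forall b, 1 <= b <= k -> potential x' [::] i' b = potential x' (y :: s) j' b) ->
    False.
  move=> c_s j0 eq_pot; have := c_s => /= /andP[c_y c_s'].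
  have [def_i|i_port] := eqVneq i' (port x' y).
    have [z z_s cz] := center _ _ (path_child_simple c_s').
    have := potential_center (child_neq_root treeT c_y) c_s' (path_child_uniq c_s') j0 z_s cz.
    have /= := eq_pot _ (col z); rewrite def_i.
    case: ifP => _; last by rewrite add0r => <-; rewrite eqxx.
    by move/eqP; rewrite -subr_eq0 opprD addrA subrr add0r oppr_eq0 => ->.
  have [z + cz] := center _ _ (path_child_simple c_s).
  rewrite inE => /predU1P[def_z|z_s]; have /= := eq_pot _ (col z).
    rewrite def_z eqxx potential_absent ?addr0; first by move/eqP; rewrite (negPf i_port).
    move=> w w_s; rewrite -def_z; apply: cz; first by rewrite inE w_s orbT.
    apply: contraTneq w_s => ->; rewrite def_z.
    by have /= /andP[] := path_child_uniq c_s.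
  have x_z : x' != z.
    by apply: contraTneq z_s => <-; have /= /andP[] := path_child_uniq c_s.
  rewrite (negPf (cz x' _ x_z)) ?inE ?eqxx // add0r => /esym/eqP.
  apply/negP; apply: potential_center => //; first exact: (child_neq_root treeT c_y).
    exact: path_child_uniq.
  by move=> w w_s; apply: cz; rewrite inE w_s orbT.
elim: p x q => [|a p IHp] x [|b q].
- move=> _ _ _ _ /(_ _ (col x)) /=; by rewrite eqxx.
- by move=> _ c_q _ j0 /(nil_cons _ _ _ _ _ c_q j0).
- move=> c_p _ i0 _ eq_pot; exfalso; apply: (nil_cons _ _ _ j _ c_p i0) => r r_k.
  by rewrite eq_pot.
move=> /= /andP[c_a c_p] /andP[c_b c_q] i0 j0 eq_pot.
(* A common first step cancels. Otherwise the separating path bends at [x]: a centre at [x] sees two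
   different ports, and a centre on one branch contributes to that side only. *)
have [def_a|a_b] := eqVneq a b.
  subst b; have [|-> ->//] := IHp a q c_p c_q i0 j0.
  by move=> r /eq_pot /addrI.
have disj := siblings_disjoint c_a c_b a_b c_p c_q.
have [z + cz0] := center _ _ (simple_path_bend c_a c_b a_b c_p c_q).
have mem_bend w : (w \in last a p :: (rev (x :: belast a p) ++ b :: q)) =
    [|| w == x, w \in a :: p | w \in b :: q].
  by rewrite -cat_cons mem_cat -rev_rcons mem_rev rcons_cons -lastI inE orbA.
have cz w : [|| w == x, w \in a :: p | w \in b :: q] -> w != z -> c w != c z.
  by rewrite -mem_bend; exact: cz0.
have x_p : x \notin a :: p.
  by have /= /andP[] : uniq (x :: a :: p) by apply: path_child_uniq; rewrite /= c_a.
have x_q : x \notin b :: q.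
  by have /= /andP[] : uniq (x :: b :: q) by apply: path_child_uniq; rewrite /= c_b.
have eq_z := eq_pot _ (col z).
rewrite mem_bend => /or3P[/eqP def_z|z_p|z_q].
- move: eq_z; rewrite def_z eqxx !potential_absent ?addr0.
  + by move/(port_inj c_a c_b) => eq_ab; rewrite eq_ab eqxx in a_b.
  + move=> w w_q; rewrite -def_z; apply: cz; first by rewrite w_q !orbT.
    by rewrite def_z; apply: contraTneq w_q => ->.
  + move=> w w_p; rewrite -def_z; apply: cz; first by rewrite w_p !orbT.
    by rewrite def_z; apply: contraTneq w_p => ->.
- have x_z : x != z by apply: contraTneq z_p => <-.
  move: eq_z; rewrite (negPf (cz x _ x_z)) ?eqxx // !add0r (@potential_absent b).
    move/eqP=> pot0; exfalso; move: pot0; apply/negP; apply: potential_center => //.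
    + exact: (child_neq_root treeT c_a).
    + exact: path_child_uniq.
    + by move=> w w_p; apply: cz; rewrite w_p orbT.
  move=> w w_q; apply: cz; first by rewrite w_q !orbT.
  by apply: contraTneq w_q => ->; exact: disj.
- have x_z : x != z by apply: contraTneq z_q => <-.
  move: eq_z; rewrite (negPf (cz x _ x_z)) ?eqxx // !add0r (@potential_absent a).
    move/esym/eqP=> pot0; exfalso; move: pot0; apply/negP; apply: potential_center => //.
    + exact: (child_neq_root treeT c_b).
    + exact: path_child_uniq.
    + by move=> w w_p; apply: cz; rewrite w_p !orbT.
  move=> w w_p; apply: cz; first by rewrite w_p !orbT.
  by apply: contraTneq w_p => ->; apply/negP => /disj; rewrite z_q.
Qed.

Lemma connect_child_root v : connect child root v.
Proof.
have [n] := ubnP (depth v); elim: n v => // n IHn v lt_n.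
have [->//|/(ex_parent treeT)[u c_uv]] := eqVneq v root.
apply: connect_trans (connect1 c_uv); apply: IHn.
by rewrite -(depth_child c_uv).
Qed.

Lemma linear_coloring_card : #|V| * d <= d.+1 ^ k.
Proof.
have /choice[P PP] : forall v, exists p, path child root p /\ last root p = v.
  by move=> v; have /connectP[p c_p ->] := connect_child_root v; exists p.
(* Each edge is recorded at its upper end, through one of the [d] nonzero exits; only exit 0 of the
   root is left out. The shift [b.+1] matches colours starting at 1. *)
pose h (vi : V * 'I_d) : {ffun 'I_k -> 'I_d.+1} :=
  [ffun b : 'I_k => potential root (P vi.1) (lift ord0 vi.2) b.+1].
have inj_h : injective h.
  move=> [v i] [w j] /ffunP eq_h.
  have [cv lv] := PP v; have [cw lw] := PP w.
  have [||b b_k|eqP' /lift_inj ->] := potential_inj cv cw (i := lift ord0 i) (j := lift ord0 j).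
  - by rewrite -val_eqE.
  - by rewrite -val_eqE.
  - case: b b_k => // b b_k; have := eq_h (Ordinal b_k); by rewrite !ffunE.
  - by rewrite -lv -lw eqP'.
by have := leq_card h inj_h; rewrite card_prod card_ffun !card_ord.
Qed.

End LinearColoring.

(** * Rank lists and the recursion satisfied by the ranks *)

Section SchafferRanking.

Variables (V : finType) (e : rel V) (root : V).
Hypothesis treeT : is_tree e.

Local Notation depth := (depth e root).
Local Notation child := (child e root).
Local Notation children := (children e root).
Local Notation subtree := (subtree e root).
Local Notation rank_list := (rank_list e root).
Local Notation next_rank := (next_rank e root).

(** A simple path from [u] ending in its subtree only descends, which opens rank lists to induction
    along child edges. *)
Lemma mem_rank_list (f : V -> nat) u a :
  a \in rank_list f u <->
  exists p, [/\ path child u p, f (last u p) = a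
              & forall z, z \in u :: p -> z != last u p -> f z < a].
Proof.
split=> [/mapP[w]|[p [c_p <- dom]]].
  rewrite mem_filter mem_enum => /andP[/asboolP[p [sp <- dom]] w_u] ->.
  by exists p; split=> //; apply: (simple_path_child treeT).
apply/map_f; rewrite mem_filter mem_enum; apply/andP; split.
  by apply/asboolP; exists p; split=> //; apply: (path_child_simple c_p).
by rewrite inE; apply/connectP; exists p.
Qed.

Lemma rank_list_rec (f : V -> nat) v a :
  a \in rank_list f v <->
  a = f v \/ exists u, [/\ child v u, a \in rank_list f u & f v < a].
Proof.
split=> [/mem_rank_list[[|u p] [/= c_p fa dom]]|].
- by left.
- case/andP: c_p => c_u c_p; right; exists u; split=> //.
    apply/mem_rank_list; exists p; split=> // z z_p; apply: dom.
    by rewrite inE z_p orbT.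
  apply: dom; rewrite ?inE ?eqxx //; apply/eqP => v_last.
  have /andP[_] : simple_path e v (u :: p) by apply: (@path_child_simple _ _ root); rewrite /= c_u.
  by rewrite cons_uniq {1}v_last mem_last.
case=> [->|[u [c_u /mem_rank_list[p [c_p fa dom]] lt_a]]]; apply/mem_rank_list.
  by exists [::]; split=> // z; rewrite mem_seq1 => /eqP ->; rewrite eqxx.
exists (u :: p); rewrite /= c_u; split=> // z; rewrite inE => /predU1P[->//|].
exact: dom.
Qed.

Lemma rank_list_eq (f g : V -> nat) u :
  (forall w, w \in subtree u -> f w = g w) -> rank_list f u = rank_list g u.
Proof.
move=> eq_fg; have sub p z : simple_path e u p -> last u p \in subtree u ->
    z \in u :: p -> z \in subtree u.
  by move=> sp /(simple_path_child treeT sp) /path_connect c_p /c_p; rewrite inE.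
have imp (f1 g1 : V -> nat) w : (forall w, w \in subtree u -> f1 w = g1 w) ->
    w \in subtree u -> dominates_path e f1 u w -> dominates_path e g1 u w.
  move=> eq1 w_u [p [sp def_w dom]]; exists p; split=> // z z_p z_w.
  by rewrite -!eq1 ?dom //; apply: (sub p); rewrite ?def_w.
rewrite /Defs.rank_list.
have -> : [seq w <- enum (subtree u) | `[< dominates_path e f u w >]] =
          [seq w <- enum (subtree u) | `[< dominates_path e g u w >]].
  apply: eq_in_filter => w; rewrite mem_enum => w_u.
  by apply/asboolP/asboolP; apply: imp => // z z_u; rewrite eq_fg.
by apply/eq_in_map => w; rewrite mem_filter mem_enum => /andP[_ /eq_fg].
Qed.

Lemma next_rank_eq (f g : V -> nat) v :
  (forall w, depth v < depth w -> f w = g w) -> next_rank f v = next_rank g v.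
Proof.
move=> eq_fg.
have eqL u : child v u -> rank_list f u = rank_list g u.
  move=> c_u; apply: rank_list_eq => w; rewrite inE => /connect_child_depth.
  by rewrite (depth_child c_u); exact: eq_fg.
have eqC : child_ranks e root f v = child_ranks e root g v.
  congr flatten; apply/eq_in_map => u; rewrite mem_enum inE; exact: eqL.
have eqM : max_repeated e root f v = max_repeated e root g v.
  rewrite /max_repeated eqC; apply: eq_bigl => a; congr (_ <= #|pred_of_set _|).
  by apply/setP => u; rewrite !inE; case: (boolP (child v u)) => // /eqL ->.
by apply: eq_ex_minn => m; rewrite eqC eqM.
Qed.

Local Notation r := (schaffer e root).

(** Vertices are processed by decreasing depth, each once: when [v] is reached, all deeper ranks are
    final, and [next_rank] at [v] reads only those. *)
Lemma schaffer_rec v : r v = next_rank r v.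
Proof.
set step := fun (f : V -> nat) v w => if w == v then next_rank f v else f w.
have fold_notin s f w : w \notin s -> foldl step f s w = f w.
  elim: s f => //= x s IHs f; rewrite inE negb_or => /andP[w_x /IHs ->].
  by rewrite /step (negPf w_x).
set s := sort (fun u v => depth v <= depth u) (enum V).
have [s1 [s2 def_s]] : exists s1 s2, s = s1 ++ v :: s2.
  by have /splitPr[s1 s2] : v \in s; [rewrite mem_sort mem_enum|exists s1, s2].
have Us : uniq s by rewrite sort_uniq enum_uniq.
have sorted_s : sorted (fun u v => depth v <= depth u) s.
  by apply: sort_sorted => x y; apply: leq_total.
have step_v : r v = next_rank (foldl step (fun=> 0) s1) v.
  rewrite /schaffer -/s -/step def_s foldl_cat /= fold_notin; last first.
    by move: Us; rewrite def_s cat_uniq /= => /and3P[_ _ /andP[]].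
  by rewrite /step eqxx.
rewrite {1}step_v; apply: next_rank_eq => w lt_vw.
rewrite /schaffer -/s -/step def_s foldl_cat [in RHS]fold_notin //.
move: sorted_s; rewrite def_s sorted_pairwise; last first.
  by move=> y x z /[swap]; apply: leq_trans.
rewrite pairwise_cat pairwise_cons => /and3P[_ _ /andP[/allP le_v _]].
rewrite inE negb_or; apply/andP; split.
  by apply: contraTneq lt_vw => ->; rewrite ltnn.
by apply/negP => /le_v; rewrite leqNgt lt_vw.
Qed.

Lemma mem_child_ranks (f : V -> nat) v a :
  reflect (exists2 u, child v u & a \in rank_list f u) (a \in child_ranks e root f v).
Proof.
apply: (iffP flatten_mapP) => [[u]|[u c_u a_u]].
  by rewrite mem_enum inE; exists u.
by exists u; rewrite // mem_enum inE.
Qed.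

Lemma rank_list_repeated v u w a : child v u -> child v w -> u != w ->
  a \in rank_list r u -> a \in rank_list r w -> a < r v.
Proof.
move=> c_u c_w u_w a_u a_w; rewrite schaffer_rec /next_rank.
case: ex_minnP => m /andP[lt_m _] _; apply: leq_ltn_trans lt_m.
apply: (@leq_bigmax_seq _ _ _ (fun k => k)).
  by apply/mem_child_ranks; exists u.
rewrite (cardD1 u) (cardD1 w) !inE c_u c_w a_u a_w eq_sym u_w.
by [].
Qed.

Lemma schaffer_notin_rank_list v u : child v u -> r v \notin rank_list r u.
Proof.
move=> c_u; rewrite {1}schaffer_rec /next_rank; case: ex_minnP => m /andP[_].
by move=> m_notin _; apply: contraNN m_notin => m_u; apply/mem_child_ranks; exists u.
Qed.

Lemma schaffer_gt0 v : 0 < r v.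
Proof.
rewrite schaffer_rec /next_rank; case: ex_minnP => m /andP[lt_m _] _.
exact: leq_ltn_trans lt_m.
Qed.

(** * Counting vertices by powers of two of the ranks *)

Definition multiplicity v (a : nat) : nat :=
  #|[set u in children v | a \in rank_list r u]|.

Lemma max_repeated_multiplicity v : let x := max_repeated e root r v in
  x = 0 \/ 2 <= multiplicity v x.
Proof.
apply: (big_ind (fun x => x = 0 \/ 2 <= multiplicity v x)); [by left| |by right].
by move=> x y Hx Hy; rewrite /maxn; case: ifP.
Qed.

Lemma max_repeated_lt v : max_repeated e root r v < r v.
Proof. by rewrite [r v]schaffer_rec /next_rank; case: ex_minnP => m /andP[]. Qed.

(** By minimality of [r v], such a rank was rejected only because it occurs in the list of some
    child. *)
Lemma multiplicity_gt0 v a : max_repeated e root r v < a < r v -> 0 < multiplicity v a.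
Proof.
case/andP=> lt_a; rewrite [r v]schaffer_rec /next_rank.
case: ex_minnP => m _ min_m lt_m; have: a \in child_ranks e root r v.
  by apply/negPn/negP => a_notin; move: (min_m a); rewrite lt_a a_notin leqNgt lt_m => /(_ isT).
case/mem_child_ranks => u c_u a_u; rewrite /multiplicity; apply/card_gt0P; exists u.
by rewrite !inE c_u.
Qed.

(** Binary carry: two copies of [2 ^ x] make [2 ^ x.+1], and each rank above [x] present below [r v]
    doubles the total. The constant 2 starts the carry when [x = 0]. *)
Lemma pow2_rank_le v : 2 ^ r v <= 2 + \sum_(a < r v) multiplicity v a * 2 ^ a.
Proof.
set x := max_repeated e root r v; have lt_x : x < r v := max_repeated_lt v.
have sum_pow m : x < m -> m <= r v ->
    2 ^ m <= 2 + \sum_(a < m) multiplicity v a * 2 ^ a.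
  elim: m => // m IHm; rewrite ltnS leq_eqVlt => /predU1P[<- le_m|lt_m le_m].
    rewrite big_ord_recr /= expnS.
    have := max_repeated_multiplicity v; rewrite /= -/x => -[->|mul_x].
      by rewrite muln1 leq_addr.
    by rewrite addnA; apply: leq_trans (leq_addl _ _); rewrite leq_mul2r mul_x orbT.
  rewrite big_ord_recr /= addnA expnS mul2n -addnn leq_add ?IHm ?(ltnW le_m) //.
  by rewrite leq_pmull // multiplicity_gt0 // lt_m.
exact: sum_pow.
Qed.

(** Subtrees of distinct children are disjoint, and [v] lies in none of them, whence strictness. *)
Lemma sum_card_subtree v : \sum_(u in children v) #|subtree u| < #|subtree v|.
Proof.
rewrite (cardD1 v (subtree v)) inE connect0 add1n ltnS.
under eq_bigr => u _ do rewrite -sum1_card.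
rewrite (exchange_big_dep [in [predD1 subtree v & v]]) /=; last first.
  move=> u w; rewrite !inE => c_u uw; apply/andP; split.
    apply: contraTneq (connect_child_depth uw) => ->.
    by rewrite (depth_child c_u) ltnn.
  exact: connect_trans (connect1 c_u) uw.
rewrite -sum1_card; apply: leq_sum => w _; rewrite sum1_card.
apply/card_le1_eqP => u u'; rewrite -!topredE /= !inE => /andP[c_u uw] /andP[c_u' u'w].
by apply: (connect_child_eq treeT u'w uw); rewrite (depth_child c_u) (depth_child c_u').
Qed.

Lemma sum_multiplicity v N : \sum_(0 <= a < N) multiplicity v a * 2 ^ a =
  \sum_(u in children v) \sum_(0 <= a < N) (a \in rank_list r u) * 2 ^ a.
Proof.
rewrite exchange_big /=; apply: eq_bigr => a _; rewrite -big_distrl /=; congr (_ * _).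
rewrite /multiplicity -sum1dep_card big_mkcondr /=.
by apply: eq_bigr => u _; case: ifP.
Qed.

(** Indicators over a common range [N] count each rank once and allow the sums of all children to be
    exchanged. *)
Lemma sum_rank_list_le v N : (forall w, r w < N) ->
  \sum_(0 <= a < N) (a \in rank_list r v) * 2 ^ a <= #|subtree v|.*2.
Proof.
move=> lt_N; have [n] := ubnP #|subtree v|; elim: n v => // n IHn v le_n.
have step : \sum_(0 <= a < N) (a \in rank_list r v) * 2 ^ a <=
    2 + \sum_(0 <= a < N) multiplicity v a * 2 ^ a.
  (* Split at [r v]: smaller ranks disappear from the list of [v] and pay for [2 ^ r v]; larger ones
     are inherited from children. *)
  rewrite !(@big_cat_nat _ _ _ (r v) 0 N) ?(ltnW (lt_N v)) //=.
  rewrite big1_seq ?add0n => [|a]; last first.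
    case/andP=> _; rewrite mem_index_iota => /andP[_ lt_a].
    have /negP/negPf-> // : ~ a \in rank_list r v.
    move=> /rank_list_rec[def_a|[u [_ _]]]; first by rewrite def_a ltnn in lt_a.
    by move=> /ltn_trans /(_ lt_a); rewrite ltnn.
  rewrite addnA big_ltn // [X in _ <= _ + X]big_ltn //.
  have -> : r v \in rank_list r v by apply/rank_list_rec; left.
  rewrite mul1n leq_add //; first by rewrite big_mkord pow2_rank_le.
  apply: leq_trans (leq_addl _ _); rewrite big_nat_cond [leqRHS]big_nat_cond.
  apply: leq_sum => a /andP[/andP[lt_a _] _]; rewrite leq_mul2r; apply/orP; right.
  case: (boolP (a \in rank_list r v)) => //.
  case/rank_list_rec => [def_a|[u [c_u a_u _]]]; first by rewrite def_a ltnn in lt_a.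
  by rewrite /multiplicity; apply/card_gt0P; exists u; rewrite !inE c_u.
apply: leq_trans step _; rewrite sum_multiplicity.
(* The constant 2 is the share of [v] itself in the doubled size. *)
apply: (@leq_trans (2 + \sum_(u in children v) #|subtree u|.*2)).
  rewrite leq_add2l; apply: leq_sum => u u_v; apply: IHn.
  move: le_n; rewrite ltnS; apply: leq_trans; apply: leq_ltn_trans (sum_card_subtree v).
  by rewrite (bigD1 u) //= leq_addr.
under eq_bigr do rewrite -muln2.
by rewrite -big_distrl /= muln2 -[2]/(1.*2) -doubleD leq_double add1n sum_card_subtree.
Qed.

Lemma pow2_ranking_size : 2 ^ ranking_size r <= #|V|.*2.
Proof.
have [_ _ V_gt0 _ _] := treeT; have [v def_k] := @eq_bigmax V r V_gt0.
rewrite {1}/ranking_size def_k; set N := (ranking_size r).+1.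
have lt_N w : r w < N by rewrite ltnS /ranking_size leq_bigmax.
apply: (@leq_trans #|subtree v|.*2); last by rewrite leq_double max_card.
apply: leq_trans (sum_rank_list_le v lt_N).
rewrite (@big_cat_nat _ _ _ (r v) 0 N) ?(ltnW (lt_N v)) //= [X in _ + X]big_ltn //.
have -> : r v \in rank_list r v by apply/rank_list_rec; left.
by rewrite mul1n addnCA leq_addr.
Qed.

(** * The computed ranks form a vertex ranking *)

(** Ties are allowed: a vertex attaining the maximum higher up puts the same rank into the list. *)
Lemma rank_list_max u p : path child u p ->
  (forall z, z \in u :: p -> r z <= r (last u p)) -> r (last u p) \in rank_list r u.
Proof.
elim: p u => [|y p IHp] u /=; first by move=> _ _; apply/rank_list_rec; left.
move=> /andP[c_y c_p] le_r; apply/rank_list_rec.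
have := le_r u; rewrite inE eqxx leq_eqVlt => /(_ isT) /predU1P[->|lt_u]; [by left|right].
exists y; split=> //; apply: IHp => // z z_p; apply: le_r; by rewrite inE z_p orbT.
Qed.

(** Follow the walk from [v] edge by edge. A step down lengthens the second branch; a step up
    shortens it or, if it is empty, raises the apex and lengthens the first. All vertices kept were
    visited, hence lie in [S]. *)
Lemma subgraph_common_ancestor (S : {set V}) f v w : is_subgraph e S f ->
    v \in S -> connect f v w ->
  exists y p q, [/\ path child y p, path child y q, last y p = v, last y q = w
                  & {subset y :: p <= S} /\ {subset y :: q <= S}].
Proof.
move=> [_ sub_f] v_S /connectP[s + ->]; elim/last_ind: s => [_|s x IHs].
  by exists v, [::], [::]; split=> //; split=> z; rewrite mem_seq1 => /eqP ->.
rewrite rcons_path last_rcons => /andP[/IHs[y [p [q [c_p c_q lp lq [Sp Sq]]]]]].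
rewrite -{}lq => /sub_f[e_x u_S x_S]; case/orP: (edge_child root treeT e_x) => c_x.
  exists y, p, (rcons q x); rewrite rcons_path c_q c_x last_rcons; split=> //.
  by split=> // z; rewrite -rcons_cons mem_rcons inE => /predU1P[->|/Sq].
case/lastP: q => [|q z] in c_q Sq u_S c_x e_x *.
  exists x, (y :: p), [::]; rewrite /= c_x; split=> //.
  by split=> z; [rewrite inE => /predU1P[->|/Sp]|rewrite mem_seq1 => /eqP ->].
move: c_q c_x; rewrite rcons_path last_rcons => /andP[c_q c_z] c_x.
exists y, p, q; split=> //; first exact: (unique_parent treeT c_z c_x).
by split=> // t t_q; apply: Sq; rewrite -rcons_cons mem_rcons inE t_q orbT.
Qed.

(** If one end is [y], its rank would lie in the list of a child, which the choice of [r y] forbids.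
    If the branches part at [y], the rank lies in two lists, so [r y] exceeds it, against
    maximality. *)
Lemma schaffer_separates y p q : path child y p -> path child y q ->
    r (last y p) = r (last y q) ->
    {in y :: p, forall z, r z <= r (last y p)} ->
    {in y :: q, forall z, r z <= r (last y p)} ->
  last y p = last y q.
Proof.
elim: p y q => [|a p IHp] y [|b q] //=.
- move=> _ /andP[c_b c_q] def_r _ le_r.
  have := schaffer_notin_rank_list c_b; rewrite def_r rank_list_max //.
  by move=> z z_q; rewrite -def_r le_r // inE z_q orbT.
- move=> /andP[c_a c_p] _ def_r le_r _.
  have := schaffer_notin_rank_list c_a; rewrite -def_r rank_list_max //.
  by move=> z z_p; rewrite le_r // inE z_p orbT.
move=> /andP[c_a c_p] /andP[c_b c_q] def_r le_p le_q.
have le_p' : {in a :: p, forall z, r z <= r (last a p)}.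
  by move=> z z_p; rewrite le_p // inE z_p orbT.
have le_q' : {in b :: q, forall z, r z <= r (last a p)}.
  by move=> z z_q; rewrite le_q // inE z_q orbT.
have [def_a|a_b] := eqVneq a b; first by subst b; apply: IHp.
have := le_p y; rewrite inE eqxx leqNgt => /(_ isT) /negP[].
apply: (rank_list_repeated c_a c_b a_b); first exact: rank_list_max.
by rewrite def_r; apply: rank_list_max => // z; rewrite -def_r; apply: le_q'.
Qed.

Lemma schaffer_vertex_ranking : vertex_ranking e (ranking_size r) r.
Proof.
split=> [v|S f [sub_f /set0Pn[v0 v0_S] conn_f]].
  by rewrite schaffer_gt0 /ranking_size leq_bigmax.
have [v v_S max_v0] := arg_maxnP r v0_S.
have max_v z : z \in S -> r z <= r v by move/max_v0.
exists v; split=> // w w_S w_v.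
rewrite ltn_neqAle (max_v w w_S) andbT; apply: contra_neqN w_v => /eqP eq_r.
have [y [p [q [c_p c_q lp lq [Sp Sq]]]]] :=
  subgraph_common_ancestor sub_f v_S (conn_f v w v_S w_S).
rewrite -lp -lq; apply/esym/schaffer_separates; rewrite // lp ?lq //.
  by move=> z /Sp /max_v.
by move=> z /Sq /max_v.
Qed.

End SchafferRanking.

(** * From the two counting bounds to the logarithmic bound *)

Lemma vertex_ranking_centered (V : finType) (e : rel V) k r :
  vertex_ranking e k r -> centered_coloring e k r.
Proof.
move=> [col_r rank_r]; split=> // S f /rank_r[v [v_S max_v]].
by exists v; split=> // w w_S w_v; rewrite ltn_eqF ?max_v.
Qed.

Lemma ler_log2_pow (R : realType) (k p m : nat) : 0 < m -> 2 ^ k <= m ^ p ->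
  (k%:R <= log2 (m%:R : R) * p%:R)%R.
Proof.
move=> m_gt0 le_pow; have ln2_gt0 : (0 < ln 2 :> R)%R by rewrite ln_gt0 // ltr1n.
rewrite /log2 mulrAC ler_pdivlMr // mulr_natl mulr_natr -!lnXn ?ltr0n //.
by rewrite ler_ln ?posrE ?exprn_gt0 ?ltr0n // -!natrX ler_nat.
Qed.

Theorem theorem4 (R : realType) (V : finType) (e : rel V) (Delta : nat)
  (root : V) (treeT : is_tree e) (maxdeg : max_degree e = Delta)
  (Delta_ge3 : (3 <= Delta)%N) :
  let r := schaffer e root in
  let k := ranking_size r in
  [/\ vertex_ranking e k r,
      centered_coloring e k r,
      (k%:R <= log2 (Delta%:R : R) * (chi_lin e)%:R)%R
    & Delta = 3 -> (k%:R <= log2 (3 : R) * (chi_lin e)%:R)%R].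
Proof.
move=> r k; have rank_r : vertex_ranking e k r := schaffer_vertex_ranking root treeT.
have bound : (k%:R <= log2 (Delta%:R : R) * (chi_lin e)%:R)%R.
  apply: ler_log2_pow; first exact: leq_trans Delta_ge3.
  have [c lin_c] : exists c, linear_coloring e (chi_lin e) c.
    by rewrite /chi_lin; case: ex_minnP => n /asboolP.
  have degree_le v : degree e v <= Delta.-1.+1.
    by rewrite (ltn_predK Delta_ge3) -maxdeg /max_degree leq_bigmax.
  have := linear_coloring_card root treeT degree_le lin_c.
  rewrite (ltn_predK Delta_ge3); apply: leq_trans.
  (* The two counts meet because [Delta >= 3] gives [2 <= Delta.-1]. *)
  apply: leq_trans (pow2_ranking_size root treeT) _.
  by rewrite -muln2 leq_mul2l -ltnS (ltn_predK Delta_ge3) Delta_ge3 orbT.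
split=> //; first exact: vertex_ranking_centered.
by move=> def_Delta; rewrite def_Delta in bound.
Qed.
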